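(* Let $M:\mathcal X\times[0,1]\to\mathcal T$ be a data-release mechanism with seed $U\sim\mathrm{Unif}[0,1]$ inducing the probability $P_x$ on $M(x,U)$ (where $x$ is taken as fixed). Suppose that $d(x,x')$ is equal to the length of a shortest path between $x$ and $x'$ in a graph on $\mathcal X$ with unit-length edges. For $0\le\epsilon<\infty$, the following statements are equivalent: (I) $M$ is $\epsilon$-differentially private. (II) $P_{x'}(S)\le e^{\epsilon}P_x(S)$ for all $S\in\mathscr F$ and all $x,x'\in\mathcal X$ with $d(x,x')=1$. (III) For all $\delta\in\mathbb N$ and all $x,x'\in\mathcal X$ with $d(x,x')=\delta$, $P_{x'}\in\mathcal I_1(L_{x,\delta\epsilon},U_{x,\delta\epsilon})$, where $L_{x,\delta\epsilon}=e^{-\delta\epsilon}P_x$ and $U_{x,\delta\epsilon}=e^{\delta\epsilon}P_x$. (IV) For all $x\in\mathcal X$ and all measures $\nu\in\Omega$, if $P_x$ has a density $p_x$ with respect to $\nu$, then every $x'\in[x]$ also has a density $p_{x'}$ of $P_{x'}$ with respect to $\nu$ satisfying $$e^{-\epsilon d(x,x')}p_x(t)\le p_{x'}(t)\le e^{\epsilon d(x,x')}p_x(t)\quad\text{for all }t\in\mathcal T.$$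
   Context: $\mathcal X$ is a set (the data universe) equipped with a metric $d:\mathcal X\times\mathcal X\to[0,\infty]$ (metrics are allowed to take the value $\infty$). $(\mathcal T,\mathscr F)$ is a measurable space. A data-release mechanism is a function $M:\mathcal X\times[0,1]\to\mathcal T$ such that $M(x,\cdot)$ is $(\mathcal B[0,1],\mathscr F)$-measurable for each $x$. For $x\in\mathcal X$, $P_x$ is the probability measure on $(\mathcal T,\mathscr F)$ given by $P_x(S)=\lambda(\{u\in[0,1]:M(x,u)\in S\})$, $\lambda$ being Lebesgue measure. For measures $\mu,\nu$ on $(\mathcal T,\mathscr F)$, the multiplicative distance is $d_{\mathrm{Mult}}(\mu,\nu)=\sup_{S\in\mathscr F}\left|\ln\frac{\mu(S)}{\nu(S)}\right|$, with $0/0=\infty/\infty=1$. $M$ is $\epsilon$-differentially private ($\epsilon$-DP) if $d_{\mathrm{Mult}}(P_x,P_{x'})\le\epsilon\,d(x,x')$ for all $x,x'\in\mathcal X$, where on the right-hand side $0\times\infty=\infty$. $\Omega$ is the set of $\sigma$-finite measures on $(\mathcal T,\mathscr F)$ and $\Omega_1$ the set of probability measures. For measures write $\mu\le\nu$ if $\mu(S)\le\nu(S)$ for all $S\in\mathscr F$. For $L\le U$, $\mathcal I(L,U)=\{\mu\text{ a measure on }(\mathcal T,\mathscr F):L\le\mu\le U\}$ and $\mathcal I_1(L,U)=\mathcal I(L,U)\cap\Omega_1$. The connected component of $x$ is $[x]=\{x'\in\mathcal X:d(x,x')<\infty\}$. A density means a Radon-Nikodym derivative. *)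

(* Defs.v *)
From HB Require Import structures.
From mathcomp Require Import all_boot all_order all_algebra.
From mathcomp Require Import all_classical all_reals all_analysis.

Set Implicit Arguments.
Unset Strict Implicit.
Unset Printing Implicit Defensive.

Import Order.TTheory GRing.Theory Num.Theory.
Import numFieldNormedType.Exports.

Local Open Scope classical_set_scope.
Local Open Scope ring_scope.
Local Open Scope ereal_scope.

Definition emetric (R : realType) (X : Type) (d : X -> X -> \bar R) : Prop :=
  [/\ forall x y, 0 <= d x y,
      forall x y, d x y = 0 <-> x = y,
      forall x y, d x y = d y x
    & forall x y z, d x z <= d x y + d y z].

Definition component (R : realType) (X : Type) (d : X -> X -> \bar R) (x : X)
  : set X := [set x' | d x x' < +oo].

(* [path] allows repeated vertices; the minimal length is the same as over
   simple paths.  The infimum of the empty set is +oo. *)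
Definition graph_dist (R : realType) (X : Type) (e : rel X) (x y : X)
  : \bar R :=
  ereal_inf [set (size p)%:R%:E | p in [set p | path e x p /\ last x p = y]].

(* d is the shortest-path distance of some undirected graph on X; loops are
   permitted as they do not affect the distance. *)
Definition is_graph_dist (R : realType) (X : Type) (d : X -> X -> \bar R)
  : Prop :=
  exists2 e : rel X, symmetric e & forall x y, d x y = graph_dist R e x y.

(* The values of the function for seeds outside [0, 1] are irrelevant: both
   measurability and [law] only see its restriction to [0, 1]. *)
Record mechanism (R : realType) (X : Type) (disp : measure_display)
    (T : measurableType disp) := Mechanism {
  mech_fun :> X -> R -> T ;
  mech_measurable : forall x, measurable_fun (`[0%R, 1%R]%classic : set R) (mech_fun x) }.

Definition law (R : realType) (X : Type) (disp : measure_display)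
    (T : measurableType disp) (M : mechanism R X T) (x : X) (S : set T)
  : \bar R :=
  lebesgue_measure [set u : R | `[0%R, 1%R]%classic u /\ S (M x u)].

Section law_probability.
Context (R : realType) (X : Type) (disp : measure_display)
        (T : measurableType disp) (M : mechanism R X T) (x : X).

Let preim (S : set T) : set R := `[0%R, 1%R] `&` M x @^-1` S.

Let measurable_preim S : measurable S -> measurable (preim S).
Proof. by move=> mS; apply: (mech_measurable M x). Qed.

Let lawE S : law M x S = lebesgue_measure (preim S).
Proof. by []. Qed.

Let law0 : law M x set0 = 0.
Proof. by rewrite lawE /preim preimage_set0 setI0 measure0. Qed.

Let law_ge0 S : 0 <= law M x S.
Proof. exact: measure_ge0. Qed.

Let law_sigma_additive : semi_sigma_additive (law M x).
Proof.
move=> F mF tF mUF; rewrite lawE /preim preimage_bigcup setI_bigcupr.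
apply: measure_semi_sigma_additive.
- by move=> n; exact: measurable_preim.
- apply/trivIsetP => /= i j _ _ ij.
  rewrite setIACA setIid -preimage_setI.
  by move/trivIsetP : tF => /(_ _ _ _ _ ij) ->//; rewrite preimage_set0 setI0.
- by rewrite -setI_bigcupr -preimage_bigcup; exact: measurable_preim.
Qed.

HB.instance Definition _ := isMeasure.Build _ _ _ (law M x)
  law0 law_ge0 law_sigma_additive.

Let law_setT : law M x setT = 1.
Proof.
by rewrite lawE /preim preimage_setT setIT lebesgue_measure_itv /=
  lte_fin ltr01 sube0.
Qed.

HB.instance Definition _ :=
  Measure_isProbability.Build _ _ _ (law M x) law_setT.

End law_probability.

(* a / b with 0 / 0 = oo / oo = 1; in the library 0 / 0 = oo / oo = 0. *)
Definition ratio (R : realType) (a b : \bar R) : \bar R :=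
  if (a == 0) && (b == 0) || (a == +oo) && (b == +oo) then 1 else a / b.

(* a * b with 0 * oo = oo; in the library 0 * oo = 0. *)
Definition mule_top (R : realType) (a b : \bar R) : \bar R :=
  if (a == 0) && (b == +oo) || (a == +oo) && (b == 0) then +oo else a * b.

Section measures.
Context (R : realType) (disp : measure_display) (T : measurableType disp).
Implicit Types mu nu L U : {measure set T -> \bar R}.

Definition dmult mu nu : \bar R :=
  ereal_sup [set `|lne (ratio (mu S) (nu S))| | S in [set S | measurable S]].

Definition le_measure_fun mu nu : Prop :=
  forall S, measurable S -> mu S <= nu S.

Definition measure_itv L U : set {measure set T -> \bar R} :=
  [set mu | le_measure_fun L mu /\ le_measure_fun mu U].

Definition proba_measures : set {measure set T -> \bar R} :=
  [set mu | mu setT = 1].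

Definition measure_itv1 L U : set {measure set T -> \bar R} :=
  measure_itv L U `&` proba_measures.

Definition is_density nu mu (p : T -> R) : Prop :=
  [/\ measurable_fun setT p,
      forall t, (0 <= p t)%R
    & forall S, measurable S -> mu S = \int[nu]_(t in S) (p t)%:E].

Definition exp_scale (a : R) mu : {measure set T -> \bar R} :=
  mscale (NngNum (expR_ge0 a)) mu.

End measures.

Definition diff_private (R : realType) (X : Type) (d : X -> X -> \bar R)
    (disp : measure_display) (T : measurableType disp) (M : mechanism R X T)
    (eps : R) : Prop :=
  forall x x', dmult (law M x) (law M x') <= mule_top eps%:E (d x x').

(* Main.v *)
Require Import Defs.
From mathcomp Require Import all_boot all_order all_algebra.
From mathcomp Require Import all_classical all_reals all_analysis.
From mathcomp Require Import measurable_realfun lra.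
Import Order.TTheory GRing.Theory Num.Theory.
Import numFieldNormedType.Exports.
Local Open Scope classical_set_scope.
Local Open Scope ring_scope.
Local Open Scope ereal_scope.

(** Up to the conventions for infinite values, differential privacy says that
   the laws P_x and P_x' satisfy the two-sided bound e^-c P_x <= P_x' <= e^c P_x
   as measures, where c = eps * d(x, x'): for finite measures, the
   multiplicative distance is at most c exactly when this bound holds
   ([dmult_leP], through the scalar case [abse_lne_ratio_le]).  At distance 1
   this contains the one-edge bound P_x' <= e^eps P_x.

   Conversely, a finite graph distance is attained by a path
   ([graph_dist_attained]), and multiplying the one-edge bound along a shortest
   path ([path_bound]) gives the upper bound at every distance delta; the lower
   bound is the upper bound for the exchanged pair.

   If p is a density of P_x with respect to nu, then P_x', being dominated by
   a multiple of P_x, is absolutely continuous with respect to nu, and the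
   Radon-Nikodym theorem gives it some density q.  The inequalities between q
   and p hold only almost everywhere, so q is clamped to
   max(e^-c p, min(q, e^c p)).  That clamping does not change the measure
   follows from [is_density_min] and [is_density_max]: if mu <= mu', f is a
   density of mu and g one of mu', then min(f, g) is again a density of mu and
   max(f, g) one of mu'.  Finally, the statement on densities gives back
   differential privacy by taking nu = P_x, of which the constant 1 is a
   density, and integrating the pointwise bounds. *)

(** * Logarithms of ratios *)

Lemma abse_lne_ratio_le (R : realType) (a b c : R) :
  (0 <= a)%R -> (0 <= b)%R -> (0 <= c)%R ->
  (`|lne (Defs.ratio a%:E b%:E)| <= c%:E) <->
  (b <= expR c * a /\ a <= expR c * b)%R.
Proof.
move=> + + c0; rewrite /Defs.ratio !le0r => /orP[/eqP->|a0] /orP[/eqP->|b0].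
- by rewrite !eqxx orTb lne1 abse0 lee_fin mulr0 lexx.
(* When exactly one of a and b is 0, the ratio is 0 or +oo, so that both sides
   are false. *)
- rewrite eqxx !eqe (gt_eqF b0) orFb mul0e mulr0 le0_lneNy//=.
  by rewrite leye_eq; split=> // -[]; rewrite leNgt b0.
- rewrite eqxx !eqe (gt_eqF a0) orFb inve0 gt0_muley ?lte_fin//= mulr0.
  by rewrite leye_eq; split=> // -[_]; rewrite leNgt a0.
rewrite !eqe (gt_eqF a0) (gt_eqF b0) orFb inver (gt_eqF b0) -EFinM.
have ab0 : (0 < a / b)%R by exact: divr_gt0.
rewrite lne_EFin// abse_EFin lee_fin ler_norml.
rewrite -[(- c <= _)%R]ler_expR -[(ln _ <= _)%R]ler_expR lnK ?posrE//.
rewrite ler_pdivrMr// ler_pdivlMr// expRN ler_pdivrMl ?expR_gt0//.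
by split=> [/andP//|[-> ->]].
Qed.

(** * Shortest paths *)

Lemma graph_dist_attained (R : realType) (X : Type) (e : rel X) (x y : X) :
  graph_dist R e x y < +oo ->
  exists p, [/\ path e x p, last x p = y
    & graph_dist R e x y = (size p)%:R%:E].
Proof.
move=> /ereal_inf_lt[_ [q [pq lq] <-] _].
pose P n := `[< exists p, [/\ path e x p, last x p = y & size p = n] >].
have exP : exists n, P n by exists (size q); apply/asboolP; exists q.
case: (ex_minnP exP) => n /asboolP[p [pp lp <-]] minp.
exists p; split=> //; apply/eqP; rewrite eq_le; apply/andP; split.
  by apply: ge_ereal_inf; exists (size p)%:R%:E => //; exists p.
apply/ereal_infP => _ [r [pr lr] <-]; rewrite lee_fin ler_nat.
by apply: minp; apply/asboolP; exists r.
Qed.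

Lemma graph_dist_edge (R : realType) (X : Type) (e : rel X) (x y : X) :
  e x y -> x <> y -> graph_dist R e x y = 1.
Proof.
move=> exy xy; apply/eqP; rewrite eq_le; apply/andP; split.
  by apply: ge_ereal_inf; exists 1 => //; exists [:: y]; rewrite //= exy.
apply/ereal_infP => _ [[|z r] [_ /= lr] <-] //.
by rewrite lee_fin (ler_nat _ 1).
Qed.

(** If a nonnegative function grows at most by the factor e^c along each edge
   with distinct ends, it grows at most by e^(c n) along a path of length n; a
   loop in the path costs nothing since 1 <= e^c. *)
Lemma path_bound (R : realType) (X : Type) (e : rel X) (f : X -> \bar R)
    (c : R) :
  (0 <= c)%R -> (forall x, 0 <= f x) ->
  (forall x y, e x y -> x <> y -> f y <= (expR c)%:E * f x) ->
  forall p x, path e x p -> f (last x p) <= (expR ((size p)%:R * c))%:E * f x.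
Proof.
move=> c0 f0 fe; elim=> [|y p IHp] x /=; first by rewrite mul0r expR0 mul1e.
move=> /andP[exy /IHp/le_trans]; apply.
rewrite -[(size p).+1]addn1 natrD mulrDl mul1r expRD EFinM -muleA.
apply: lee_wpmul2l; first by rewrite lee_fin expR_ge0.
have [->|/fe] := pselect (x = y); last exact.
by apply: lee_pemull; rewrite // lee_fin -expR0 ler_expR.
Qed.

(** * Densities of comparable measures *)

Section densities.
Context (R : realType) (disp : measure_display) (T : measurableType disp).
Implicit Types nu mu : {measure set T -> \bar R}.

(** Replacing a density on a measurable set by another function having the
   same integrals over the measurable subsets of that set. *)
Lemma is_density_if nu mu (f g : T -> R) (A : set T) :
  measurable A -> is_density nu mu f -> measurable_fun setT g ->
  (forall t, (0 <= g t)%R) ->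
  (forall S, measurable S -> S `<=` A -> mu S = \int[nu]_(t in S) (g t)%:E) ->
  is_density nu mu (fun t => if t \in A then g t else f t).
Proof.
move=> mA [mf f0 fE] mg g0 gE.
have h0 t : (0 <= if t \in A then g t else f t)%R by case: ifP.
have mh : measurable_fun setT (fun t => if t \in A then g t else f t).
  apply: measurable_fun_ifT => //.
  apply: (measurable_fun_bool true); rewrite setTI.
  rewrite (_ : _ @^-1` _ = A)//; apply/seteqP.
  by split=> t /= => [/set_mem|/mem_set].
split=> // S mS.
have mSA := measurableI _ _ mS mA; have mSD := measurableD mS mA.
rewrite -{2}(setUIDK S A) ge0_integral_setU//; last 3 first.
- exact/measurable_EFinP/measurable_funTS.
- by move=> t _; rewrite lee_fin.
- by apply/disj_setPS => t [[_ At] [_ /(_ At)]].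
rewrite -{1}(setUIDK S A) measureU//; last first.
  by apply/seteqP; split=> t // [[_ At] [_ /(_ At)]].
congr (_ + _).
- apply: etrans (gE _ mSA _) _; first exact: subIsetr.
  apply: eq_integral => t; rewrite inE => -[_ At].
  by rewrite mem_set.
- apply: etrans (fE _ mSD) _; apply: eq_integral => t; rewrite inE => -[_ At].
  by rewrite memNset.
Qed.

(** The densities and the measures are compared in opposite directions, which
   forces equality. *)
Lemma is_density_eq_on nu mu mu' (f g : T -> R) (S : set T) :
  is_density nu mu f -> is_density nu mu' g -> measurable S ->
  mu S <= mu' S -> (forall t, S t -> (g t <= f t)%R) ->
  mu S = mu' S.
Proof.
move=> [mf f0 fE] [mg g0 gE] mS le_mu gf.
apply/eqP; rewrite eq_le le_mu/= fE// gE//.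
apply: ge0_le_integral => //.
- by move=> t _; rewrite lee_fin.
- exact/measurable_EFinP/measurable_funTS.
- exact/measurable_EFinP/measurable_funTS.
Qed.

(** On the set where g <= f, the two measures agree, so f may be replaced there
   by g. *)
Lemma is_density_min nu mu mu' (f g : T -> R) :
  is_density nu mu f -> is_density nu mu' g -> le_measure_fun mu mu' ->
  is_density nu mu (fun t => Num.min (f t) (g t)).
Proof.
move=> df dg le_mu; have [mf f0 fE] := df; have [mg g0 gE] := dg.
have mA : measurable [set t | (g t <= f t)%R].
  by rewrite -[X in measurable X]setTI; exact: measurable_fun_le.
have -> : (fun t => Num.min (f t) (g t)) =
    (fun t => if t \in [set t | (g t <= f t)%R] then g t else f t).
  apply/funext => t; rewrite minC /Order.min; case: ifPn => [/ltW gf|].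
    by rewrite mem_set.
  case: ifPn => //; rewrite inE/= => gf; rewrite -leNgt => fg.
  by apply/eqP; rewrite eq_le gf fg.
apply: is_density_if => // S mS SA; rewrite -gE//.
by apply: is_density_eq_on df dg _ (le_mu _ _) _ => // t /SA.
Qed.

(** Dually, the two measures agree on the set where g <= f, so g may be replaced
   there by f. *)
Lemma is_density_max nu mu mu' (f g : T -> R) :
  is_density nu mu f -> is_density nu mu' g -> le_measure_fun mu mu' ->
  is_density nu mu' (fun t => Num.max (f t) (g t)).
Proof.
move=> df dg le_mu; have [mf f0 fE] := df; have [mg g0 gE] := dg.
have mA : measurable [set t | (g t <= f t)%R].
  by rewrite -[X in measurable X]setTI; exact: measurable_fun_le.
have -> : (fun t => Num.max (f t) (g t)) =
    (fun t => if t \in [set t | (g t <= f t)%R] then f t else g t).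
  apply/funext => t; case: ifPn; rewrite ?inE ?notin_setE/= => h.
    exact: max_l.
  by apply/max_r/ltW; rewrite ltNge; exact/negP.
apply: is_density_if => // S mS SA; rewrite -fE//.
by apply/esym; apply: is_density_eq_on df dg _ (le_mu _ _) _ => // t /SA.
Qed.

Lemma is_density_exp_scale nu mu (f : T -> R) (a : R) :
  is_density nu mu f ->
  is_density nu (exp_scale a mu) (fun t => (expR a * f t)%R).
Proof.
move=> [mf f0 fE]; split.
- exact: measurable_funM.
- by move=> t; rewrite mulr_ge0 ?expR_ge0.
move=> S mS; under eq_integral do rewrite EFinM.
rewrite ge0_integralZl_EFin ?expR_ge0// -?fE//.
- by move=> t _; rewrite lee_fin.
- exact/measurable_EFinP/measurable_funTS.
Qed.

(** Radon-Nikodym for a finite measure lying below a measure with a density. *)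
Lemma is_density_dominated (nu : {sigma_finite_measure set T -> \bar R})
    (mu : {finite_measure set T -> \bar R}) (mu' : {measure set T -> \bar R})
    (f : T -> R) :
  le_measure_fun mu mu' -> is_density nu mu' f ->
  exists g, is_density nu mu g.
Proof.
move=> le_mu [mf f0 fE].
have mu_nu : mu `<< nu.
  apply/null_content_dominatesP => A mA nuA.
  apply/eqP; rewrite eq_le measure_ge0 andbT.
  rewrite (le_trans (le_mu _ mA))// fE// null_set_integral//.
  exact/measurable_funTS/measurable_EFinP.
have [g [g0 gfin intg gE]] := radon_nikodym_sigma_finite mu_nu.
exists (fine \o g); split.
- by apply: measurableT_comp => //; exact: measurable_int intg.
- by move=> t /=; rewrite fine_ge0.
move=> S mS; apply: etrans (gE _ mS) _; apply: eq_integral => t _.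
by rewrite /= fineK.
Qed.

(** A measure between e^-c mu and e^c mu has a density satisfying the
   corresponding bounds everywhere, not merely almost everywhere. *)
Lemma is_density_between (nu : {sigma_finite_measure set T -> \bar R})
    (mu : {measure set T -> \bar R}) (mu' : {finite_measure set T -> \bar R})
    (c : R) (p : T -> R) :
  (0 <= c)%R -> is_density nu mu p ->
  measure_itv (exp_scale (- c) mu) (exp_scale c mu) mu' ->
  exists2 p', is_density nu mu' p' &
    forall t, (expR (- c) * p t <= p' t <= expR c * p t)%R.
Proof.
move=> c0 dp [Lmu muU]; have [_ p0 _] := dp.
have dL := is_density_exp_scale nu mu p (- c)%R dp.
have dU := is_density_exp_scale nu mu p c dp.
have [q dq] := is_density_dominated nu mu' _ _ muU dU.
(* the Radon-Nikodym density q clamped between the two required bounds *)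
exists (fun t => Num.max (expR (- c) * p t) (Num.min (q t) (expR c * p t)))%R.
  apply: is_density_max dL _ Lmu; exact: is_density_min dq dU muU.
move=> t; rewrite le_max lexx/= ge_max ge_min lexx orbT andbT.
by rewrite ler_wpM2r// ler_expR; lra.
Qed.

Lemma is_density_cst1 mu : is_density mu mu (cst 1%R).
Proof.
by split=> // S mS; rewrite -[LHS]mul1e; exact/esym/(integral_cst mu mS 1).
Qed.

Lemma is_density_between_bounds nu mu mu' (p p' : T -> R) (a b : R) :
  is_density nu mu p -> is_density nu mu' p' ->
  (forall t, (expR a * p t <= p' t <= expR b * p t)%R) ->
  measure_itv (exp_scale a mu) (exp_scale b mu) mu'.
Proof.
move=> dp [mp' p'0 p'E] le_p.
have [ma a0 aE] := is_density_exp_scale nu mu p a dp.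
have [mb b0 bE] := is_density_exp_scale nu mu p b dp.
split=> S mS; rewrite ?aE ?bE ?p'E//; apply: ge0_le_integral => //;
  try exact/measurable_EFinP/measurable_funTS;
  by move=> t _; rewrite lee_fin//; case/andP: (le_p t).
Qed.

(** * The multiplicative distance *)

Lemma exp_scaleE mu (a : R) S : exp_scale a mu S = (expR a)%:E * mu S.
Proof. by []. Qed.

Lemma exp_scaleN_le mu mu' (c : R) S :
  (exp_scale (- c) mu S <= mu' S) = (mu S <= exp_scale c mu' S).
Proof.
rewrite !exp_scaleE expRN.
by rewrite lee_pdivrMl// expR_gt0.
Qed.

Lemma dmult_leP mu mu' (c : R) :
  fin_num_fun mu -> fin_num_fun mu' -> (0 <= c)%R ->
  (dmult mu mu' <= c%:E) <->
  measure_itv (exp_scale (- c) mu) (exp_scale c mu) mu'.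
Proof.
move=> mu_fin mu'_fin c0.
have key S : measurable S -> (`|lne (Defs.ratio (mu S) (mu' S))| <= c%:E) <->
    (mu' S <= exp_scale c mu S /\ mu S <= exp_scale c mu' S).
  move=> mS; rewrite !exp_scaleE.
  rewrite -(fineK (mu_fin _ mS)) -(fineK (mu'_fin _ mS)).
  rewrite -!EFinM !lee_fin.
  by apply: abse_lne_ratio_le => //; exact: fine_ge0.
split.
- move=> /ereal_supP h.
  have bound S : measurable S ->
      mu' S <= exp_scale c mu S /\ mu S <= exp_scale c mu' S.
    by move=> mS; apply/key => //; apply: h; exists S.
  by split=> S /bound[//]; rewrite exp_scaleN_le.
- move=> [hL hU]; apply/ereal_supP => _ [S mS <-]; apply/key => //.
  by split; [exact: hU|rewrite -exp_scaleN_le; exact: hL].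
Qed.

End densities.

Theorem theorem6 (R : realType) (X : Type) (d : X -> X -> \bar R)
    (disp : measure_display) (T : measurableType disp) (M : mechanism R X T)
    (eps : R)
    (d_metric : emetric d) (d_graph : is_graph_dist d)
    (eps_ge0 : (0 <= eps)%R) :
  [<->
    (* (I) *)
    diff_private d M eps ;
    (* (II) *)
    forall S : set T, measurable S -> forall x x' : X, d x x' = 1 ->
      law M x' S <= (expR eps)%:E * law M x S ;
    (* (III) *)
    forall (delta : nat) (x x' : X), d x x' = delta%:R%:E ->
      measure_itv1 (exp_scale (- (delta%:R * eps)) (law M x))
                   (exp_scale (delta%:R * eps) (law M x))
                   (law M x') ;
    (* (IV) *)
    forall (x : X) (nu : {sigma_finite_measure set T -> \bar R})
           (p : T -> R), is_density nu (law M x) p ->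
      forall x' : X, component d x x' ->
      exists2 p' : T -> R, is_density nu (law M x') p' &
        forall t : T,
          (expR (- (eps * fine (d x x'))) * p t <= p' t
             <= expR (eps * fine (d x x')) * p t)%R ].
Proof.
have [d_ge0 _ d_sym _] := d_metric.
have [e _ dE] := d_graph.
tfae.
- move=> DP S mS x x' dxx'.
  have := DP x x'; rewrite dxx' /mule_top !andbF/= ?mule1.
  by move=> /dmult_leP[]// _ /(_ _ mS).
- move=> edge.
  (* only the upper bound: the lower one is the same with x and x' exchanged *)
  have bound (n : nat) x x' S : measurable S -> d x x' = n%:R%:E ->
      law M x' S <= exp_scale (n%:R * eps) (law M x) S.
    move=> mS dn.
    have [|p [pp lp dp]] := @graph_dist_attained R X e x x'.
      by rewrite -dE dn ltry.
    have <- : size p = n.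
      by apply/eqP; rewrite -(eqr_nat R) -eqe -dp -dE dn.
    rewrite exp_scaleE -lp.
    apply: (@path_bound R X e (fun y => law M y S)) => // y z eyz yz.
    by apply: edge => //; rewrite dE graph_dist_edge.
  move=> n x x' dn; split; last exact: probability_setT.
  split=> S mS; last exact: bound.
  by rewrite exp_scaleN_le; apply: bound => //; rewrite d_sym.
- move=> itv x nu p dp x' dfin.
  have [|q [_ _ dq]] := @graph_dist_attained R X e x x'; first by rewrite -dE.
  rewrite dE dq /= mulrC.
  apply: is_density_between dp _; first exact: mulr_ge0.
  by have [] := itv (size q) x x' (etrans (dE _ _) dq).
- move=> dens x x'.
  have [dfin|] := ltP (d x x') +oo; last first.
    (* with 0 * oo = oo, the bound is vacuous between distinct components *)
    rewrite leye_eq => /eqP ->; rewrite /mule_top.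
    case: eqVneq; rewrite /= ?leey// => eps_neq0.
    by rewrite gt0_muley ?leey// lt0e eps_neq0 lee_fin.
  (* P_x itself serves as the reference measure *)
  have [p' dp' p'_bnd] := dens x (law M x) _ (is_density_cst1 _ _ _ _) x' dfin.
  have -> : mule_top eps%:E (d x x') = (eps * fine (d x x'))%:E.
    rewrite /mule_top (lt_eqF dfin) andbF/= EFinM fineK//.
    by rewrite ge0_fin_numE.
  apply/dmult_leP; rewrite ?mulr_ge0 ?fine_ge0//; try exact: fin_num_measure.
  exact: is_density_between_bounds (is_density_cst1 _ _ _ _) dp' p'_bnd.
Qed.
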